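(* Let $r$ be an integer with $r \geq 3$ and $r \neq 5$. Then every $r$-regular graph $G$ has a zero-sum $5$-flow; that is, there exists a function $f : E(G) \to \{\pm 1, \pm 2, \pm 3, \pm 4\}$ such that for every vertex $v \in V(G)$ the sum of the values $f(e)$ over all edges $e$ incident with $v$ is zero.
   Context: Graphs are finite and undirected, with vertex set $V(G)$ and edge set $E(G)$; multiple edges and loops are allowed. A graph is $r$-regular if every vertex has degree $r$. A loop at a vertex contributes $2$ to the degree of that vertex, and correspondingly its value is counted twice in the sum of values of edges incident with that vertex; parallel edges are distinct edges and may receive different values. A zero-sum flow of $G$ is an assignment of non-zero real numbers to the edges of $G$ such that the sum of the values of all edges incident with each vertex is zero. For a natural number $k$, a zero-sum $k$-flow is a zero-sum flow with values in $\{\pm 1, \ldots, \pm (k-1)\}$. *)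

(* Defs.v *)
From mathcomp Require Import all_boot all_order all_algebra.

Set Implicit Arguments.
Unset Strict Implicit.
Unset Printing Implicit Defensive.

Import GRing.Theory Num.Theory.
Local Open Scope ring_scope.

(* Finite undirected multigraphs, loops allowed. Edges form a type of their own,
   so parallel edges are distinct. [ends e] lists the two ends of [e] in an
   arbitrary order, which no notion below depends on; [e] is a loop when both
   components coincide. *)
Record multigraph := Multigraph {
  vertex : finType;
  edge : finType;
  ends : edge -> vertex * vertex
}.

(* Number of times [e] is incident with [v]: 2 when [e] is a loop at [v]. *)
Definition incidence (G : multigraph) (v : vertex G) (e : edge G) : nat :=
  (((ends e).1 == v) + ((ends e).2 == v))%N.

Definition degree (G : multigraph) (v : vertex G) : nat :=
  (\sum_(e : edge G) incidence v e)%N.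

Definition regular (r : nat) (G : multigraph) : Prop :=
  forall v : vertex G, degree v = r.

(* The coefficient [incidence v e] counts the value of a loop twice. *)
Definition zero_sum_flow (R : numDomainType) (G : multigraph)
    (f : edge G -> R) : Prop :=
  (forall e, f e != 0) /\
  (forall v : vertex G, \sum_(e : edge G) f e *+ incidence v e = 0).

(* Values in {+-1, ..., +-(k-1)}: nonzero integers of absolute value < k. *)
Definition zero_sum_kflow (k : nat) (G : multigraph)
    (f : edge G -> int) : Prop :=
  zero_sum_flow f /\ (forall e, 1 <= `|f e| < k%:Z).

(* Main.v *)
(* Write each edge as two darts; the bipartite double cover of an r-regular graph
   splits into perfect matchings, so a dart labelling y with vertex sums zero on
   both sides yields the zero-sum flow f e = y d + y d', with d and d' the darts
   of e. If a subgraph H has degree k everywhere, r <= 3k <= 2r, take y = -1 - z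
   on H and y = 2 - z off H, with z the indicator of 2r - 3k of the matchings:
   then |f| is 2, 3 or 4. For r = 3 the labels 1, 1, -2 on the three matchings
   suffice.

   For r even Tutte's theorem supplies H directly. For r odd, k = (r-1)/2 and H
   need exist only when there is no bridge, so the graph is cut at its bridges and
   each piece X solved with the edges leaving X as half-edges, free to be in H or
   not. Such an edge gets a value in {+-2, +-4}, and on any one of them every such
   value is reachable (by negation and by permuting the matchings), which allows
   the pieces to be glued back along the tree of bridges. *)

Require Import Defs.
From mathcomp Require Import all_boot all_order all_algebra.
From mathcomp Require Import zify.

Set Implicit Arguments.
Unset Strict Implicit.
Unset Printing Implicit Defensive.

Import GRing.Theory Num.Theory.

(** * Tutte's theorem *)

Section Tutte.

Variable T : finType.
Implicit Types (e : rel T) (m : T -> T) (s : seq T) (U : {set T})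
  (P : {set {set T}}).

Definition perfect_matching e m : Prop :=
  forall x, [/\ m (m x) = x, m x != x & e x (m x)].

Definition odd_blocks P : {set {set T}} := [set K in P | odd #|K|].

(** Blocks are unions of components of the complement of [U], not necessarily single ones: an odd
    union contains an odd component, so Tutte's condition fails all the same. *)
Definition barrier e U P : Prop :=
  [/\ partition P (~: U),
      forall K x y, K \in P -> x \in K -> e x y -> y \notin U -> y \in K
    & #|U| < #|odd_blocks P|].

Fixpoint paired e s : bool :=
  match s with
  | [::] => true
  | [:: _] => false
  | [:: x, y & s'] => e x y && paired e s'
  end.

Lemma seq2_ind (Q : seq T -> Prop) :
  Q [::] -> (forall x, Q [:: x]) ->
  (forall x y s, Q s -> Q [:: x, y & s]) -> forall s, Q s.
Proof.
move=> Q0 Q1 Q2 s; elim: {s}(size s) {-2}s (leqnn (size s)) => [|n IH] [|x [|y s]] //=.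
by rewrite ltnS => le_s_n; apply/Q2/IH/ltnW.
Qed.

Lemma paired_cat e s1 s2 : paired e s1 -> paired e s2 -> paired e (s1 ++ s2).
Proof.
elim/seq2_ind: s1 => //= x y s IH /andP[-> ps] ps2.
exact: IH.
Qed.

Lemma paired_clique e s :
    uniq s -> ~~ odd (size s) -> {in s &, forall x y, x != y -> e x y} ->
  paired e s.
Proof.
elim/seq2_ind: s => //= x y s IH /and3P[]; rewrite inE negb_or => /andP[xNy _] _ us.
rewrite negbK => ev es; apply/andP; split.
  by apply: es; rewrite ?inE ?eqxx ?orbT.
by apply: IH => // a b sa sb; apply: es; rewrite !inE ?sa ?sb !orbT.
Qed.

Lemma paired_matching e s : symmetric e -> uniq s -> paired e s ->
  exists m, {in s, forall x, [/\ m (m x) = x, m x != x, e x (m x) & m x \in s]}.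
Proof.
move=> sym_e; elim/seq2_ind: s => [_ _|//|x y s IH] /=; first by exists id.
case/and3P; rewrite inE negb_or => /andP[xNy xNs] yNs us /andP[exy ps].
have [m Hm] := IH us ps.
exists (fun z => if z == x then y else if z == y then x else m z) => z.
have yNx : (y == x) = false by rewrite eq_sym; apply: negbTE.
rewrite !inE; have [->|zNx] := eqVneq z x.
  by rewrite yNx eqxx; split; rewrite ?inE ?yNx ?eqxx ?orbT.
have [->|zNy] /= := eqVneq z y.
  by rewrite eqxx; split; rewrite ?inE ?eqxx // sym_e.
move=> zs; have [mmz mzNz emz mzs] := Hm z zs.
have -> : (m z == x) = false by apply: contraNF xNs => /eqP <-.
have -> : (m z == y) = false by apply: contraNF yNs => /eqP <-.
by split; rewrite ?mzs ?orbT.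
Qed.

(* Each clique of odd size is completed by one of the universal vertices [us]. *)
Lemma cliques_paired e (Ks : seq (seq T)) (us : seq T) :
    symmetric e ->
    uniq (flatten Ks ++ us) ->
    {in Ks, forall K, {in K &, forall x y, x != y -> e x y}} ->
    {in us, forall u y, y != u -> e u y} ->
    count (fun K => odd (size K)) Ks <= size us ->
    ~~ odd (size (flatten Ks ++ us)) ->
  exists2 s, perm_eq s (flatten Ks ++ us) & paired e s.
Proof.
move=> sym_e; elim: Ks us => [|K Ks IH] us /=.
  move=> uus _ univ _ ev; exists us => //.
  by apply: paired_clique => // x y xs ys xNy; apply: univ; rewrite // eq_sym.
rewrite -catA cat_uniq => /and3P[uK /hasPn disjK uus] cliq univ.
have cliqK : {in K &, forall x y, x != y -> e x y}.
  by apply: cliq; rewrite mem_head.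
have cliqKs : {in Ks, forall K', {in K' &, forall x y, x != y -> e x y}}.
  by move=> K' K'in; apply: cliq; rewrite inE K'in orbT.
rewrite size_cat oddD; case oddK: (odd (size K)) => /=; last first.
  rewrite add0n => cnt ev; have [s ps es] := IH us uus cliqKs univ cnt ev.
  exists (K ++ s); first by rewrite perm_cat2l.
  by apply: paired_cat => //; apply: paired_clique; rewrite ?oddK.
case: us uus disjK univ => [|u us] // uus disjK univ.
rewrite /= add1n ltnS => cnt; rewrite negbK size_cat /= addnS /= -size_cat => ev.
have uniq_us : uniq (u :: flatten Ks ++ us).
  by rewrite -(perm_uniq (s1 := flatten Ks ++ u :: us)) // perm_catC /= perm_cons perm_catC.
move: (uniq_us) => /= /andP[uNrest urest].
have [|s ps es] := IH us urest cliqKs _ cnt ev.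
  by move=> v vus; apply: univ; rewrite inE vus orbT.
have uNK : u \notin K by apply: (disjK u); rewrite mem_cat mem_head orbT.
exists ((K ++ [:: u]) ++ s).
  rewrite -catA perm_cat2l /=.
  apply: (@perm_trans _ (u :: flatten Ks ++ us)); first by rewrite perm_cons.
  by rewrite perm_sym perm_catC /= perm_cons perm_catC.
apply: paired_cat => //; apply: paired_clique.
- by rewrite cat_uniq uK /= orbF andbT.
- by rewrite size_cat addn1 /= oddK.
have univu : forall y, y != u -> e u y by apply: univ; rewrite mem_head.
move=> x y; rewrite !mem_cat !inE => /orP[xK|/eqP->] /orP[yK|/eqP->] xNy.
- exact: cliqK.
- by rewrite sym_e univu.
- by rewrite univu // eq_sym.
- by rewrite eqxx in xNy.
Qed.

Definition adjacent_all e : {set T} := [set x | [forall y, (y != x) ==> e x y]].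

(** The saturated case of Lovász's proof: off the universal vertices adjacency is transitive, so
    components are cliques. Either the odd cliques outnumber the universal vertices, or each borrows
    one of them and the rest pairs off. *)
Lemma clique_components_tutte e :
    symmetric e ->
    (forall a b c, b \notin adjacent_all e -> a != b -> b != c -> a != c ->
       e a b -> e b c -> e a c) ->
  (exists m, perfect_matching e m) \/ (exists U P, barrier e U P).
Proof.
move=> sym_e trans_e.
have [oddT|evT] := boolP (odd #|T|).
  (* At odd order the whole vertex set is one odd block against an empty [U]. *)
  right; exists set0, [set [set: T]]; split.
  - apply/and3P; split; rewrite ?cover1 ?trivIset1 ?setC0 // in_set1.
    by apply/eqP=> T0; move: oddT; rewrite -cardsT -T0 cards0.
  - by move=> K x y /set1P-> _ _ _; rewrite inE.
  - rewrite cards0 card_gt0; apply/set0Pn; exists setT.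
    by rewrite inE in_set1 eqxx cardsT.
set U := adjacent_all e.
pose R : rel T := [rel x y | (x == y) || e x y].
have equivR : {in ~: U & &, equivalence_rel R}.
  move=> x y z; rewrite !in_setC => xU yU zU; split; first by rewrite /R /= eqxx.
  rewrite /R /=; case: (eqVneq x y) => [->//|xNy] /= exy.
  have [<-|xNz] := eqVneq x z; first by rewrite (sym_e y) exy orbT.
  have [<-|yNz] //= := eqVneq y z.
  apply/idP/idP => [exz|eyz]; last exact: (trans_e x y z).
  by apply: (trans_e y x z); rewrite // 1?eq_sym // sym_e.
have := equivalence_partitionP equivR.
set P := equivalence_partition R (~: U) => partP.
have blockR K x y : K \in P -> x \in K -> y \in K -> R x y.
  move=> KP xK yK; have trivP := partition_trivIset partP.
  rewrite -(def_pblock trivP KP xK) in yK.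
  have xU : x \in ~: U by rewrite -(cover_partition partP); apply/bigcupP; exists K.
  have yU : y \in ~: U.
    rewrite -(cover_partition partP); apply/bigcupP; exists (pblock P x) => //.
    by rewrite pblock_mem // (cover_partition partP).
  by rewrite -(pblock_equivalence_partition equivR).
have [leU|ltU] := leqP #|odd_blocks P| #|U|; last first.
  right; exists U, P; split=> // K x y KP xK exy yU.
  have xU : x \in ~: U by rewrite -(cover_partition partP); apply/bigcupP; exists K.
  have trivP := partition_trivIset partP.
  rewrite -(def_pblock trivP KP xK) (pblock_equivalence_partition equivR) //=.
    by rewrite /R /= exy orbT.
  by rewrite inE.
left.
pose Ks := [seq enum (A : {set T}) | A <- enum P]; pose us := enum U.
have memK x : (x \in flatten Ks) = (x \notin U).
  rewrite -in_setC -(cover_partition partP); apply/flattenP/bigcupP.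
    by case=> _ /mapP[A + ->]; rewrite !mem_enum => AP xA; exists A.
  by case=> A AP xA; exists (enum A); rewrite ?mem_enum //; apply: map_f; rewrite mem_enum.
have size_flat : size (flatten Ks) = #|~: U|.
  rewrite size_flatten /shape -map_comp (card_partition partP) sumnE big_map big_enum /=.
  by apply: eq_bigr => A _; rewrite -cardE.
have perm_all : perm_eq (flatten Ks ++ us) (enum T).
  rewrite perm_sym.
  have subE : {subset enum T <= flatten Ks ++ us}.
    by move=> x _; rewrite mem_cat memK mem_enum orNb.
  have sz : size (flatten Ks ++ us) <= size (enum T).
    by rewrite size_cat size_flat -!cardE addnC cardsC.
  have [_ eqE] := uniq_min_size (enum_uniq T) subE sz.
  apply: uniq_perm; rewrite ?enum_uniq //.
  by rewrite (leq_size_uniq (enum_uniq T) subE sz).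
have uall : uniq (flatten Ks ++ us) by rewrite (perm_uniq perm_all) enum_uniq.
have szall : size (flatten Ks ++ us) = #|T| by rewrite (perm_size perm_all) -cardE.
have [||||s ps es] := cliques_paired sym_e uall.
- move=> _ /mapP[A AP ->] x y; rewrite !mem_enum in AP * => xA yA xNy.
  by have := blockR A x y AP xA yA; rewrite /R /= (negbTE xNy).
- by move=> u; rewrite mem_enum inE => /forallP univ y yNu; apply: (implyP (univ y)).
- rewrite -cardE count_map; apply: leq_trans leU.
  rewrite -size_filter cardE; apply: uniq_leq_size.
    by rewrite filter_uniq ?enum_uniq.
  by move=> A; rewrite mem_filter !mem_enum /= -cardE inE andbC.
- by rewrite szall.
have us_s : uniq s by rewrite (perm_uniq ps).
have [m Hm] := paired_matching sym_e us_s es.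
exists m => x; have [|? ? ? _] := Hm x; last by split.
by rewrite (perm_mem ps) (perm_mem perm_all) mem_enum.
Qed.

End Tutte.

(** * Exchange of matchings and reduction to the saturated case *)

Section TutteTheorem.

Variable T : finType.
Implicit Types (e : rel T) (m : T -> T) (U : {set T}) (P : {set {set T}}).

Definition add_edge e a c : rel T :=
  [rel x y | [|| e x y, (x == a) && (y == c) | (x == c) && (y == a)]].

Lemma add_edge_sym e a c : symmetric e -> symmetric (add_edge e a c).
Proof.
move=> sym_e x y; rewrite /add_edge /= sym_e.
by rewrite [(y == a) && _]andbC [(y == c) && _]andbC [X in _ || X]orbC.
Qed.

(** Alternating cycles are even, and [m1 x] sits at odd distance from [x]. Applying [m2] and then
    [m1] to a supposed coincidence moves both ends inward, until [m1] or [m2] would have a fixed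
    point. *)
Lemma alternating_walk_mate (m1 m2 : T -> T) :
    involutive m1 -> involutive m2 ->
    (forall x, m1 x != x) -> (forall x, m2 x != x) ->
  forall n x, m1 x != iter n (m2 \o m1) x.
Proof.
move=> K1 K2 N1 N2; elim/ltn_ind=> -[|[|n]] IH x /=; first exact: N1.
  by rewrite eq_sym N2.
apply/eqP => eq_m; have /eqP := IH n (ltnW (ltnSn _)) (m2 (m1 x)); apply.
apply: (can_inj K1); apply: (can_inj K2); rewrite K1 K2 [LHS]eq_m.
by congr (m2 (m1 _)); exact: (iterSr n (m2 \o m1) x).
Qed.

(** Lovász's exchange. The walk from [d] alternating between [m1] and [m2] either reaches [a] or
    [c], both adjacent to [b], or never does. In each case [m1] on the part walked and [m2]
    elsewhere, up to one edge at [b], avoid both added edges. *)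
Lemma matching_exchange e (a b c d : T) m1 m2 :
    symmetric e -> a != b -> b != c -> e a b -> e b c ->
    perfect_matching (add_edge e a c) m1 -> perfect_matching (add_edge e b d) m2 ->
  exists m, perfect_matching e m.
Proof.
move=> sym_e aNb bNc eab ebc pm1 pm2.
have K1 : involutive m1 by move=> x; case: (pm1 x).
have K2 : involutive m2 by move=> x; case: (pm2 x).
have N1 x : m1 x != x by case: (pm1 x).
have N2 x : m2 x != x by case: (pm2 x).
have E1 x : x \notin [:: a; c] -> e x (m1 x).
  rewrite !inE negb_or => /andP[/negbTE xa /negbTE xc].
  by case: (pm1 x) => _ _; rewrite /add_edge /= xa xc !orbF.
have E2 x : x \notin [:: b; d] -> e x (m2 x).
  rewrite !inE negb_or => /andP[/negbTE xa /negbTE xc].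
  by case: (pm2 x) => _ _; rewrite /add_edge /= xa xc !orbF.
have [ac1|nac1] := eqVneq (m1 a) c; last first.
  exists m1 => x; split=> //; have [_ _] := pm1 x.
  case/or3P=> // /andP[/eqP-> /eqP mx]; first by rewrite mx eqxx in nac1.
  by rewrite -mx K1 eqxx in nac1.
have [db2|ndb2] := eqVneq (m2 d) b; last first.
  exists m2 => x; split=> //; have [_ _] := pm2 x.
  case/or3P=> // /andP[/eqP-> /eqP mx]; last by rewrite mx eqxx in ndb2.
  by rewrite -mx K2 eqxx in ndb2.
have ca1 : m1 c = a by rewrite -ac1 K1.
have bd2 : m2 b = d by rewrite -db2 K2.
pose f := m2 \o m1; pose w i := iter i f d.
have wS i : w i.+1 = m2 (m1 (w i)) by [].
have walkN n x : m1 x != iter n f x by apply: alternating_walk_mate.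
have [[j wj]|noj] : (exists j, w j \in [:: a; c]) \/ (forall j, w j \notin [:: a; c]).
- have [/existsP[j wj]|/existsPn nj] := boolP [exists j : 'I_#|T|, w j \in [:: a; c]].
    by left; exists j.
  right=> j; have := iter_findex (f := f) (x := d) (y := w j).
  move=> h; have fc : fconnect f d (w j) by apply: fconnect_iter.
  rewrite -(h fc); apply: (nj (Ordinal (leq_trans (findex_max fc) (max_card _)))).
- have exj : exists j, w j \in [:: a; c] by exists j.
  move: (ex_minnP exj) => {j wj exj} [j wj minj].
  (* [C] holds the vertices walked before the first visit [w j] to [a] or [c]. It is closed under
     [m1], and adding [w j] and [b] closes it under [m2]; hence [b] can be matched with [w j]. *)
  pose C := [set x | [exists i : 'I_j, (x == w i) || (x == m1 (w i))]].
  have CP x : reflect (exists2 i, i < j & x = w i \/ x = m1 (w i)) (x \in C).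
    rewrite inE; apply: (iffP existsP) => [[i /orP[]/eqP->]|[i ltij xw]].
    + by exists i; rewrite // -/(w i); left.
    + by exists i; rewrite // -/(w i); right.
    + by exists (Ordinal ltij); case: xw => -> /=; rewrite eqxx ?orbT.
  clearbody C.
  have early i : i < j -> w i \notin [:: a; c].
    by move=> ltij; apply/negP => /minj; rewrite leqNgt ltij.
  have Cm1 x : x \in C -> m1 x \in C.
    case/CP=> i ltij [] ->; apply/CP; exists i => //; first by right.
    by rewrite K1; left.
  have Cac x : x \in C -> x \notin [:: a; c].
    case/CP=> i ltij [] ->; first exact: early.
    apply: contra (early i ltij); rewrite !inE => /orP[]/eqP eqw.
      by rewrite -[w i]K1 eqw ac1 eqxx orbT.
    by rewrite -[w i]K1 eqw ca1 eqxx.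
  have wjC : w j \notin C by apply/negP=> /Cac; rewrite wj.
  (* If [b] were some [w i], then [m2] would fix [b] or [m1 d] would be an iterate of [d]. If [b]
     were [m1 (w i)], the walk would return to [d] and visit [a] or [c] before step [j]. *)
  have bC : b \notin C.
    apply/negP=> /CP[i ltij []] bw.
      case: i => [|i] in ltij bw *; first by have := N2 b; rewrite bd2 [X in _ != X]bw eqxx.
      have /eqP := walkN i d; apply; rewrite -/(w i) -[w i]K1; congr m1.
      by rewrite -[LHS]K2 db2 bw wS K2 /=.
    have wd : w i.+1 = d by rewrite wS -bw bd2.
    have : w (j - i.+1) \in [:: a; c].
      have <- : w j = w (j - i.+1); last by [].
      rewrite -{1}(subnK ltij) {1}/w iterD; congr (iter _ _ _); exact: wd.
    by move/minj; rewrite leqNgt ltn_subrL /= (leq_ltn_trans _ ltij).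
  have wjb : w j != b.
    by apply: contraTneq wj => ->; rewrite !inE negb_or eq_sym aNb.
  have ewb : e (w j) b by move: wj; rewrite !inE => /orP[]/eqP-> //; rewrite sym_e.
  pose Q := [predU C & pred2 (w j) b].
  have wC i : i < j -> w i \in C by move=> ltij; apply/CP; exists i; last left.
  have wQ i : i <= j -> w i \in Q.
    by rewrite leq_eqVlt !inE => /predU1P[->|/wC->]; rewrite ?eqxx ?orbT.
  have m2wQ i : i <= j -> m2 (w i) \in Q.
    case: i => [|i] leij; first by rewrite [m2 _]db2 !inE eqxx !orbT.
    by rewrite wS K2 inE /= Cm1 // wC.
  have Qm2 x : x \in Q -> m2 x \in Q.
    rewrite inE => /orP[/CP[i ltij []->]|/orP[]/eqP->].
    - exact/m2wQ/ltnW.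
    - by rewrite -wS wQ.
    - exact: m2wQ.
    - by rewrite bd2 (wQ 0).
  exists (fun x => if x == b then w j else if x == w j then b
                   else if x \in C then m1 x else m2 x) => x.
  have [->|xNb] := eqVneq x b.
    by rewrite (negbTE wjb) eqxx sym_e.
  have [->|xNw] := eqVneq x (w j); first by rewrite eqxx eq_sym.
  have [xC|xC] := boolP (x \in C).
    have m1C := Cm1 x xC.
    have -> : (m1 x == b) = false by apply: contraNF bC => /eqP<-.
    have -> : (m1 x == w j) = false by apply: contraNF wjC => /eqP<-.
    by rewrite m1C K1; split=> //; apply/E1/Cac.
  have : m2 x \notin Q.
    apply: contra xC => /Qm2; rewrite K2 !inE (negbTE xNw) (negbTE xNb).
    by rewrite !orbF.
  rewrite !inE !negb_or => /and3P[/negbTE-> /negbTE-> m2b].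
  rewrite (negbTE m2b) K2; split=> //; apply: E2.
  rewrite !inE negb_or xNb /=; apply: contraNneq m2b => ->.
  by rewrite db2.
- have f_inj : injective f by apply: inj_comp; apply: can_inj.
  have Oac x : fconnect f d x -> x \notin [:: a; c].
    by move=> dx; rewrite -(iter_findex dx) noj.
  (* The whole alternating cycle through [d]: it contains [b] but neither [a] nor [c]. *)
  pose C := [set x | fconnect f d x || fconnect f d (m1 x)].
  have Cm1 x : (m1 x \in C) = (x \in C) by rewrite !inE K1 orbC.
  have Cm2' x : x \in C -> m2 x \in C.
    rewrite !inE => /orP[dx|dx].
      apply/orP; right; apply: (connect_trans dx).
      rewrite fconnect_sym //; apply: connect1; apply/eqP.
      by rewrite /f /= K1 K2.
    by apply/orP; left; apply: (connect_trans dx); apply: connect1; rewrite /= /f /= K1 eqxx.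
  have Cm2 x : (m2 x \in C) = (x \in C).
    by apply/idP/idP => [/Cm2'|/Cm2'//]; rewrite K2.
  have dC : d \in C by rewrite inE connect0.
  have bC : b \in C by rewrite -Cm2 bd2.
  exists (fun x => if x \in C then m1 x else m2 x) => x.
  have [xC|xNC] := boolP (x \in C).
    rewrite Cm1 xC K1; split=> //; apply: E1.
    move: xC; rewrite inE => /orP[/Oac//|/Oac]; apply: contra.
    by rewrite !inE => /orP[]/eqP->; rewrite ?ac1 ?ca1 eqxx ?orbT.
  rewrite Cm2 (negbTE xNC) K2; split=> //; apply: E2.
  by rewrite !inE negb_or; apply/andP; split; apply: contraNneq xNC => ->.
Qed.

(** Induction on the number of non-adjacent pairs. A barrier survives deletion of edges, so
    matchings may be assumed after adding [a c] and after adding [b d], and the exchange gets rid of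
    both edges. If no suitable path [a b c] exists, the saturated case applies. *)
Theorem tutte e : symmetric e ->
  (exists m, perfect_matching e m) \/ (exists U P, barrier e U P).
Proof.
pose nonedges (e : rel T) := #|[pred p | ~~ e p.1 p.2]|.
move: {2}(nonedges e) (leqnn (nonedges e)) => n.
elim: n e => [|n IH] e le_n sym_e.
  apply: clique_components_tutte => // a b c _ _ _ _ _ _; apply/negPn/negP=> nac.
  have : #|[pred p : T * T | ~~ e p.1 p.2]| == 0 by rewrite -leqn0.
  by move/eqP/card0_eq/(_ (a, c)); rewrite !inE /= nac.
pose bad a b c := [&& b \notin adjacent_all e, a != b, b != c, a != c, e a b, e b c & ~~ e a c].
have [/existsP[a /existsP[b /existsP[c]]]|nobad] :=
    boolP [exists a, exists b, exists c, bad a b c]; last first.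
  apply: clique_components_tutte => // a b c bU aNb bNc aNc eab ebc.
  apply/negPn/negP=> nac; move/existsPn/(_ a)/existsPn/(_ b)/existsPn/(_ c): nobad.
  by rewrite /bad bU aNb bNc aNc eab ebc nac.
case/and5P=> bU aNb bNc aNc /and3P[eab ebc nac].
move: bU; rewrite inE negb_forall => /existsP[d]; rewrite negb_imply => /andP[dNb nbd].
have step x y : ~~ e x y ->
    (exists m, perfect_matching (add_edge e x y) m) \/ (exists U P, barrier e U P).
  move=> nxy; have [|||] := IH (add_edge e x y); [|exact: add_edge_sym|by left|].
    rewrite -ltnS; apply: leq_trans le_n; apply: proper_card; apply/properP; split.
      apply/subsetP=> -[u v]; rewrite !inE /= negb_or; by case/andP.
    by exists (x, y); rewrite !inE /= ?nxy //= /add_edge /= !eqxx orbT.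
  move=> [U [P [partP closP ltP]]]; right; exists U, P; split=> // K u v KP uK euv.
  by apply: closP uK _; rewrite // /add_edge /= euv.
have [[m1 pm1]|] := step a c nac; last by right.
have [[m2 pm2]|] := step b d nbd; last by right.
left; exact: (matching_exchange sym_e aNb bNc eab ebc pm1 pm2).
Qed.

End TutteTheorem.

(** * A weighted sufficient condition for perfect matchings *)

Lemma odd_card_odd_blocks (T : finType) (D : {set T}) (P : {set {set T}}) :
  partition P D -> odd #|odd_blocks P| = odd #|D|.
Proof.
move=> partP; rewrite (card_partition partP) (big_morph odd oddD (erefl _)).
rewrite -sum1dep_card big_mkcondr (big_morph odd oddD (erefl _)).
by apply: eq_bigr => K _; case: (odd #|K|).
Qed.

(* The weights [w] replace the connectivity bookkeeping in Tutte's condition: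
   every odd block avoiding [F] draws at least [N] units from the barrier, whose
   members can each supply only [N]; the clique [F] spoils at most one block, and
   parity absorbs it. *)
Lemma weighted_tutte (T : finType) (e : rel T) (w : T -> T -> nat) (N : nat)
    (F : {set T}) :
    symmetric e -> ~~ odd #|T| -> 0 < N ->
    {in F &, forall x y, x != y -> e x y} ->
    (forall x y, x \notin F -> 0 < w y x -> e x y) ->
    (forall y, \sum_(x | x \notin F) w y x <= N) ->
    (forall K : {set T}, odd #|K| -> [disjoint K & F] ->
       N <= \sum_(x in K) \sum_(y | y \notin K) w y x) ->
  exists m, perfect_matching e m.
Proof.
move=> sym_e evT N0 cliqF supp cap cut.
have [//|[U [P [partP closP ltU]]]] := tutte sym_e; exfalso.
have trivP := partition_trivIset partP.
(* By parity the odd blocks outnumber [U] by at least two, so losing one block to [F] still leaves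
   more than [#|U|]. *)
have eqodd : odd #|odd_blocks P| = odd #|U|.
  rewrite (odd_card_odd_blocks partP); move: evT.
  by rewrite -(cardsC U) oddD; case: (odd #|U|) (odd #|~: U|) => [] [].
pose B0 := [set K in odd_blocks P | [disjoint K & F]].
pose B1 := odd_blocks P :\: B0.
have B1P K : K \in B1 -> exists x, [/\ K \in P, x \in K & x \in F].
  rewrite !inE => /andP[+ /andP[KP oddK]]; rewrite KP oddK /= => /pred0Pn[x /andP[xK xF]].
  by exists x.
have B1le : #|B1| <= 1.
  apply/card_le1_eqP => K1 K2 /B1P[x [K1P xK1 xF]] /B1P[y [K2P yK2 yF]].
  have yU : y \notin U.
    rewrite -in_setC -(cover_partition partP); by apply/bigcupP; exists K2.
  have yK1 : y \in K1.
    have [<-//|xNy] := eqVneq x y.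
    by apply: (closP K1 x y) => //; apply: cliqF.
  by rewrite -(def_pblock trivP K1P yK1) (def_pblock trivP K2P yK2).
have cardB : #|odd_blocks P| = #|B0| + #|B1|.
  rewrite -(cardsID B0 (odd_blocks P)); congr (#|pred_of_set _| + _).
  by apply/setP => K; rewrite !inE; case: (_ \in P) (odd _) => [] [].
have B0P K : K \in B0 -> [/\ K \in P, odd #|K| & [disjoint K & F]].
  by rewrite !inE => /andP[/andP[-> ->] ->].
(* Double counting of the weight from [U] into the blocks of [B0]: whatever enters such a block
   comes from [U], since blocks are closed under adjacency elsewhere. *)
have : #|B0| * N <= #|U| * N.
  rewrite -sum_nat_const -[X in _ <= X]sum_nat_const.
  apply: (@leq_trans (\sum_(K in B0) \sum_(x in K) \sum_(y in U) w y x)).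
    apply: leq_sum => K /B0P[KP oddK disK].
    apply: leq_trans (cut K oddK disK) _; apply: leq_sum => x xK.
    rewrite big_mkcond [X in _ <= X]big_mkcond /=; apply: leq_sum => y _.
    have [yK|yK] //= := boolP (y \in K).
    case: ifPn => // yU; rewrite leqNgt; apply: contra yK => /supp exy.
    by apply: (closP K x y) => //; apply: exy; rewrite (disjointFr disK).
  have trivB0 : trivIset B0.
    by apply: (trivIsetS _ trivP); apply/subsetP => K KB; case: (B0P K KB).
  rewrite -(big_trivIset (E := fun x => \sum_(y in U) w y x) _ trivB0) /= exchange_big /=; apply: leq_sum => y _.
  apply: leq_trans (cap y).
  rewrite big_mkcond [X in _ <= X]big_mkcond /=; apply: leq_sum => x _.
  case: ifP => // /bigcupP[K /B0P[_ _ disK] xK].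
  by rewrite (disjointFr disK xK).
rewrite leq_pmul2r // => leB0.
by move: ltU B1le leB0 eqodd; rewrite cardB; lia.
Qed.

(** * Matchings and edge colourings of regular bipartite multigraphs *)

Section RegularBipartite.

Variables (A L : finType) (s t : L -> A).

(** [L] is the edge set of a bipartite multigraph on two copies of [A], with ends [s] and [t].
    Degree one means a perfect matching. *)
Definition biregular r (D : {set L}) : Prop := forall a,
  #|[set l in D | s l == a]| = r /\ #|[set l in D | t l == a]| = r.

(** [X] sends out [#|X| * r] units and [Y] absorbs at most [#|Y| * r] of them. *)
Lemma unbalanced_cut r (mult : A -> A -> nat) (X Y : {set A}) :
    (forall a, \sum_b mult a b = r) -> (forall b, \sum_a mult a b = r) ->
    #|Y| < #|X| ->
  r <= \sum_(a in X) \sum_(b | b \notin Y) mult a b.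
Proof.
move=> rows cols ltYX.
have eqX : #|X| * r = \sum_(a in X) \sum_(b in Y) mult a b
                    + \sum_(a in X) \sum_(b | b \notin Y) mult a b.
  rewrite -big_split -sum_nat_const; apply: eq_bigr => a _.
  by rewrite -(rows a) (bigID (mem Y)).
have leY : \sum_(a in X) \sum_(b in Y) mult a b <= #|Y| * r.
  rewrite exchange_big -sum_nat_const; apply: leq_sum => b _.
  by rewrite -(cols b) [X in _ <= X](bigID (mem X)) leq_addr.
have : #|Y|.+1 * r <= #|X| * r by rewrite leq_mul2r ltYX orbT.
rewrite mulSn; lia.
Qed.

(** Edge multiplicities serve as weights in [weighted_tutte], with [F] empty: an odd set has halves
    of different sizes, and the larger half sends out at least [r] units. *)
Lemma biregular_matching r (D : {set L}) :
  0 < r -> biregular r D -> exists2 M : {set L}, M \subset D & biregular 1 M.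
Proof.
move=> r0 regD.
pose mult a b := #|[set l in D | (s l == a) && (t l == b)]|.
have rows a : \sum_b mult a b = r.
  rewrite -(regD a).1 -sum1dep_card (partition_big t predT) //=.
  apply: eq_bigr => b _; rewrite sum1dep_card; apply: eq_card => l.
  by rewrite !inE andbA.
have cols b : \sum_a mult a b = r.
  rewrite -(regD b).2 -sum1dep_card (partition_big s predT) //=.
  apply: eq_bigr => a _; rewrite sum1dep_card; apply: eq_card => l.
  by rewrite !inE [_ && (t l == b)]andbC andbA.
pose w (y x : A + A) := match y, x with
  | inl a, inr b | inr b, inl a => mult a b | _, _ => 0 end.
have [|||||y|K oddK _|m pm] := @weighted_tutte _ [rel x y | 0 < w x y] w r set0.
- by move=> [a|b] [a'|b'].
- by rewrite card_sum addnn odd_double.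
- exact: r0.
- by move=> x y; rewrite inE.
- by move=> [a|b] [a'|b'].
- rewrite (eq_bigl predT) => [|x]; last by rewrite inE.
  rewrite big_sumType /=; case: y => [a|b] /=.
    by rewrite big1_eq add0n rows.
  by rewrite big1_eq addn0 cols.
- pose X := [set a | inl a \in K]; pose Y := [set b | inr b \in K].
  have cardK : #|K| = #|X| + #|Y|.
    rewrite -!sum1_card big_sumType /=; congr (_ + _);
    by apply: eq_bigl => a; rewrite inE.
  have eq_cut : \sum_(x in K) \sum_(y | y \notin K) w y x =
      \sum_(a in X) \sum_(b | b \notin Y) mult a b
      + \sum_(b in Y) \sum_(a | a \notin X) mult a b.
    rewrite big_sumType /=; congr (_ + _); apply: eq_big => [a|a _];
    rewrite ?inE // big_sumType /= big1_eq ?add0n ?addn0;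
    by apply: eq_bigl => b; rewrite inE.
  rewrite eq_cut; have [ltYX|] := ltnP #|Y| #|X|.
    by apply: leq_trans (leq_addr _ _); apply: unbalanced_cut.
  rewrite leq_eqVlt => /predU1P[eqXY|ltXY].
    by rewrite cardK eqXY addnn odd_double in oddK.
  apply: leq_trans (leq_addl _ _).
  by apply: (unbalanced_cut (mult := fun a b => mult b a)).
have mE a : exists l, [/\ l \in D, s l = a & m (inl a) = inr (t l)].
  have [_ _] := pm (inl a); case: (m (inl a)) => //= b.
  rewrite card_gt0 => /set0Pn[l]; rewrite inE => /and3P[lD /eqP sl /eqP tl].
  by exists l; rewrite tl.
have [h hP] := fin_all_exists mE.
exists [set h a | a in A].
  by apply/subsetP => _ /imsetP[a _ ->]; case: (hP a).
have h_inj : injective h by move=> a b eqh; case: (hP a) (hP b) => _ <- _ [_ <- _]; rewrite eqh.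
have card1 (Q : pred L) a : (forall b, Q (h b) = (b == a)) -> #|[set l in h @: A | Q l]| = 1.
  move=> Qa; rewrite -(cards1 (h a)); apply: eq_card => l; rewrite !inE.
  apply/andP/eqP => [[/imsetP[b _ ->]]|->]; first by rewrite Qa => /eqP->.
  by rewrite imset_f // Qa eqxx.
move=> a; split.
  by apply: (card1 _ a) => b; case: (hP b) => _ -> _.
have [mma _ e_a] := pm (inr a); case ma : (m (inr a)) e_a => [a'|//] _.
apply: (card1 _ a') => b; have [_ _ mb] := hP b.
apply/eqP/eqP => [tb|->]; last first.
  by move: mma; rewrite ma; case: (hP a') => _ _ -> [].
by move: ma; rewrite -tb -mb; case: (pm (inl b)) => -> _ _ [].
Qed.

Lemma biregularD r (D M : {set L}) : M \subset D ->
  biregular r.+1 D -> biregular 1 M -> biregular r (D :\: M).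
Proof.
move=> MD regD regM a.
have cardD (Q : pred L) : #|[set l in D :\: M | Q l]| =
    #|[set l in D | Q l]| - #|[set l in M | Q l]|.
  rewrite -[in RHS](cardsID M [set l in D | Q l]).
  have -> : [set l in D | Q l] :&: M = [set l in M | Q l].
    apply/setP => l; rewrite !inE; have [lM|] := boolP (l \in M); last by rewrite andbF.
    by rewrite (subsetP MD) // andbT.
  rewrite addKn; apply: eq_card => l; rewrite !inE.
  by rewrite -andbA.
by have [[eq1 eq2] [eq3 eq4]] := (regD a, regM a); rewrite !cardD eq1 eq2 eq3 eq4 subn1.
Qed.

Lemma biregular_colouring r (D : {set L}) : biregular r D ->
  exists c : L -> nat, (forall l, l \in D -> c l < r) /\
    (forall i, i < r -> biregular 1 [set l in D | c l == i]).
Proof.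
elim: r D => [|r IH] D regD.
  exists (fun=> 0); split=> // l lD; have [/eqP + _] := regD (s l).
  by rewrite cards_eq0 => /eqP/setP/(_ l); rewrite !inE lD eqxx.
have [M MD regM] := biregular_matching (ltn0Sn r) regD.
have [c [c_lt regc]] := IH _ (biregularD MD regD regM).
exists (fun l => if l \in M then r else c l); split=> [l lD|i].
  by case: ifP => // lM; apply: ltnW; rewrite ltnS; apply: c_lt; rewrite inE lM.
rewrite ltnS leq_eqVlt => /predU1P[->|ltir].
  suff -> : [set l in D | (if l \in M then r else c l) == r] = M by [].
  apply/setP => l; rewrite inE; case: ifPn => [lM|lM].
    by rewrite eqxx (subsetP MD).
  have [lD|//] := boolP (l \in D); have := c_lt l; rewrite inE lM lD => /(_ isT).
  by case: ltngtP.
have -> // : [set l in D | (if l \in M then r else c l) == i] =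
          [set l in D :\: M | c l == i].
  apply/setP => l; rewrite !inE; case: ifPn => lM /=; last by [].
  by rewrite (gtn_eqF ltir) andbF.
exact: regc.
Qed.

End RegularBipartite.

(** * Factors of a graph without bridges *)

(** Any family of distinct pairs across a cut bounds it from below; the cut estimates for the gadget
    all have this form. *)
Lemma cut_ge (I T : finType) (w : T -> T -> nat) (K : {set T}) (D : {set I})
    (p : I -> T * T) (c : I -> nat) :
    {in D &, injective p} ->
    {in D, forall i, [/\ (p i).1 \in K, (p i).2 \notin K & c i <= w (p i).2 (p i).1]} ->
  \sum_(i in D) c i <= \sum_(x in K) \sum_(y | y \notin K) w y x.
Proof.
move=> p_inj pK; rewrite pair_big /=.
apply: (@leq_trans (\sum_(q in p @: D) w q.2 q.1)).
  by rewrite big_imset //=; apply: leq_sum => i /pK[].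
rewrite big_mkcond [X in _ <= X]big_mkcond /=; apply: leq_sum => q _.
by case: ifP => // /imsetP[i /pK[iK jK _] ->]; rewrite iK jK.
Qed.

Section Darts.

Variable G : multigraph.

(** The two darts of a loop sit at the same vertex, which yields its double contribution. *)
Definition dart : finType := (edge G * bool)%type.

Definition dend (d : dart) : vertex G := if d.2 then (ends d.1).2 else (ends d.1).1.

Definition flip (d : dart) : dart := (d.1, ~~ d.2).

Lemma flipK : involutive flip.
Proof. by case=> e b; rewrite /flip /= negbK. Qed.

Lemma flip_neq d : flip d != d.
Proof. by case: d => e []; apply/eqP; case. Qed.

Lemma sum_darts_at (R : nmodType) (v : vertex G) (f : edge G -> R) :
  (\sum_(e : edge G) f e *+ incidence v e = \sum_(d | dend d == v) f d.1)%R.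
Proof.
transitivity (\sum_e \sum_b (if dend (e, b) == v then f e else 0))%R; last first.
  by rewrite pair_bigA [RHS]big_mkcond /=; apply: eq_bigr => -[].
apply: eq_bigr => e _; rewrite big_bool /= /dend /incidence /= GRing.mulrnDr GRing.addrC.
by do 2!case: eqP.
Qed.

Lemma card_darts_at r (v : vertex G) : regular r G -> #|[set d | dend d == v]| = r.
Proof.
move=> /(_ v) <-; rewrite -sum1dep_card -(sum_darts_at v (fun=> 1)) /degree.
by apply: eq_bigr => e _; rewrite /incidence; case: (_ == _); case: (_ == _).
Qed.

Lemma card_darts_in r (Y : {set vertex G}) :
  regular r G -> #|[set d | dend d \in Y]| = #|Y| * r.
Proof.
move=> regG; rewrite -sum1dep_card (partition_big dend (mem Y)) //= -sum_nat_const.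
apply: eq_bigr => v vY; rewrite -(card_darts_at v regG) -sum1dep_card; apply: eq_bigl => d.
by case: eqP => [->|]; rewrite ?vY ?andbF.
Qed.

Lemma odd_regular r : regular r G -> odd r -> ~~ odd #|vertex G|.
Proof.
move=> regG oddr; have := card_darts_in [set: vertex G] regG.
have -> : [set d : dart | dend d \in [set: vertex G]] = setT by apply/setP => d; rewrite !inE.
rewrite !cardsT card_prod card_bool => /(congr1 odd).
by rewrite !oddM oddr andbF andbT => <-.
Qed.

Definition crossing (X Y : {set vertex G}) : {set dart} :=
  [set d | (dend d \in Y) && (dend (flip d) \in X :\: Y)].

(** An edge is a bridge of the subgraph induced on [X] exactly when it is the whole boundary inside
    [X] of some [Y]. *)
Definition bridgeless (X : {set vertex G}) : Prop :=
  forall Y : {set vertex G}, Y \subset X -> #|crossing X Y| != 1.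

Lemma even_card_flip_closed (D : {set dart}) :
  {in D, forall d, flip d \in D} -> ~~ odd #|D|.
Proof.
move=> closedD; pose D0 := [set d in D | d.2].
have -> : #|D| = #|D0| + #|flip @: D0|.
  rewrite -(cardsID D0 D); congr (_ + _).
    by congr #|pred_of_set _|; apply/setP => d; rewrite !inE andbA andbb.
  congr #|pred_of_set _|; apply/setP => d; rewrite !inE; apply/andP/imsetP => [[nD0 dD]|[d' + ->]].
    exists (flip d); rewrite ?flipK // inE closedD //=.
    by move: nD0; rewrite dD.
  rewrite inE => /andP[dD d2]; split; last exact: closedD.
  by rewrite closedD //= d2.
by rewrite card_imset ?addnn ?odd_double //; apply: can_inj flipK.
Qed.

(** Of the [#|Y| * r] darts at [Y], those on edges inside [Y] come in pairs and the others cross. *)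
Lemma odd_crossing r (X Y : {set vertex G}) : regular r G ->
    (forall d, dend d \in Y -> dend (flip d) \in X) ->
  odd #|crossing X Y| = odd (#|Y| * r).
Proof.
move=> regG YX; rewrite -(card_darts_in Y regG).
rewrite -(cardsID [set d | dend (flip d) \in Y] [set d | dend d \in Y]) oddD.
rewrite (negbTE (even_card_flip_closed (D := _ :&: _) _)) /= => [|d]; last first.
  by rewrite !inE flipK andbC.
congr odd; apply: eq_card => d; rewrite !inE andbC.
by case: (boolP (dend d \in Y)) => [/YX->|]; rewrite ?andbF ?andbT.
Qed.

(** * Tutte's gadget for factors and its cuts *)

Section Gadget.

Variables (r k : nat) (X : {set vertex G}).
Hypotheses (regG : regular r G) (r_gt0 : 0 < r) (le_r3k : r <= 3 * k) (le_2kr : 2 * k <= r).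
Hypotheses (odd_kr : odd k -> odd r) (brX : bridgeless X).

Let n := r - k.

(* Tutte's gadget for k-factors: besides its r darts, each vertex owns r - k
   cores adjacent to all of these darts; a dart left to its flip by the cores
   belongs to the factor. *)
Definition gadget : finType := (dart + vertex G * 'I_n)%type.

Definition gadget_adj (x y : gadget) : bool :=
  match x, y with
  | inl d, inl d' => d' == flip d
  | inl d, inr c | inr c, inl d => dend d == c.1
  | inr _, inr _ => false
  end.

(* Everything outside X, together with the darts of X on edges leaving X: the
   factor is unconstrained there. *)
Definition gadget_free : {set gadget} := [set x : gadget |
  match x with
  | inl d => ~~ ((dend d \in X) && (dend (flip d) \in X))
  | inr c => c.1 \notin X
  end].

(** Chosen so that each supplier [y] gives at most [r * n] to vertices that are not free: a core
    gives [n] to each of its [r] darts, a dart inside [X] gives [k * n] to its flip and [n] to each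
    of its [n] cores. The flip of a dart leaving [X] is free, so each core may get [r] instead. *)
Definition gadget_weight (y x : gadget) : nat :=
  match y, x with
  | inl d, inl d' => (d' == flip d) * (k * n)
  | inr c, inl d => (dend d == c.1) * n
  | inl d, inr c => (dend d == c.1) * (if dend (flip d) \in X then n else r)
  | inr _, inr _ => 0
  end.

Definition gadget_rel : rel gadget := [rel x y |
  gadget_adj x y || [&& x \in gadget_free, y \in gadget_free & x != y]].

Lemma gadget_rel_sym : symmetric gadget_rel.
Proof.
move=> x y; rewrite /gadget_rel /= (eq_sym y x) andbCA; congr (_ || _).
case: x y => [d|c] [d'|c'] //=; rewrite eq_sym.
by apply/eqP/eqP => [<-|->]; rewrite flipK.
Qed.

Lemma sum_cores v a : \sum_(c : vertex G * 'I_n) (v == c.1) * a = n * a.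
Proof.
transitivity (\sum_u \sum_(i < n) (v == u) * a).
  by rewrite pair_bigA; apply: eq_bigr => -[].
rewrite (bigD1 v) //= eqxx mul1n.
rewrite sum_nat_const card_ord big1 ?addn0 // => u uNv.
by rewrite eq_sym (negbTE uNv) sum_nat_const muln0.
Qed.

Let n_gt0 : 0 < n. Proof. by rewrite /n; lia. Qed.
Let knr : k + n = r. Proof. by rewrite /n; lia. Qed.
Let le_nr : n <= r. Proof. by rewrite /n; lia. Qed.

Lemma gadget_capacity y : \sum_(x | x \notin gadget_free) gadget_weight y x <= r * n.
Proof.
have bound (Q : pred gadget) (f : gadget -> nat) : \sum_(x | Q x) f x <= \sum_x f x.
  by rewrite [X in _ <= X](bigID Q) leq_addr.
case: y => [d|[v i]].
  have [fdX|fdX] := boolP (dend (flip d) \in X).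
    apply: leq_trans (bound _ _) _; rewrite big_sumType /= fdX sum_cores.
    rewrite (bigD1 (flip d)) //= eqxx mul1n big1 ?addn0 -?mulnDl ?knr // => d' dN.
    by rewrite (negbTE dN).
  rewrite big_sumType /= big1 => [|d']; last first.
    rewrite inE; case: eqP => // ->; rewrite flipK (negbTE fdX) //=.
  rewrite (negbTE fdX) add0n big_mkcond /= [X in _ <= X]mulnC -(sum_cores (dend d) r); apply: leq_sum => c _.
  by case: ifP.
apply: leq_trans (bound _ _) _; rewrite big_sumType /= [X in _ + X]big1 ?addn0 //.
rewrite -big_distrl /= leq_mul2r -(card_darts_at v regG) -sum1dep_card [X in _ <= X]big_mkcond /=.
by apply/orP; right; apply: leq_sum => d _; case: eqP.
Qed.

Lemma gadget_support x y : x \notin gadget_free -> 0 < gadget_weight y x -> gadget_rel x y.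
Proof.
move=> _; case: x y => [d|c] [d'|c'] /=; rewrite /gadget_rel //=; case: eqP => //= -> _.
by rewrite flipK eqxx.
Qed.

(** Odd [r] forces an even number of vertices, and even [r] forces [k], hence [n], to be even; so
    the number of cores is even, like that of darts. *)
Lemma even_gadget : ~~ odd #|gadget|.
Proof.
rewrite card_sum !card_prod card_bool card_ord muln2 oddD odd_double /= oddM.
have [oddr|evr] := boolP (odd r); first by rewrite (negbTE (odd_regular regG oddr)).
rewrite negb_and; apply/orP; right; rewrite -/n /n oddB; last by lia.
by rewrite (negbTE evr) /=; apply: contra evr.
Qed.

Section Cut.

Variable K : {set gadget}.
Hypotheses (oddK : odd #|K|) (disjK : [disjoint K & gadget_free]).

Let cut := \sum_(x in K) \sum_(y | y \notin K) gadget_weight y x.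

Lemma dart_in_cut d : inl d \in K -> dend d \in X /\ dend (flip d) \in X.
Proof. by move/(disjointFr disjK); rewrite inE => /negbFE/andP[]. Qed.

Lemma core_in_cut c : inr c \in K -> c.1 \in X.
Proof. by move/(disjointFr disjK); rewrite inE => /negbFE. Qed.

(** Each of the [r] darts at [v] is adjacent to both cores, so it forms a pair across the cut with
    one of them. *)
Lemma split_vertex_cut (v : vertex G) (i j : 'I_n) :
  inr (v, i) \in K -> inr (v, j) \notin K -> r * n <= cut.
Proof.
move=> iK jK; pose D := [set d | dend d == v].
pose p (d : dart) : gadget * gadget :=
  if inl d \in K then (inl d, inr (v, j)) else (inr (v, i), inl d).
have -> : r * n = \sum_(d in D) n by rewrite sum_nat_const (card_darts_at v regG).
apply: (cut_ge (p := p)) => [d d' _ _|d].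
  by rewrite /p; case: ifP => _; case: ifP => _ // [].
rewrite inE => /eqP dv; rewrite /p; case: ifPn => dK; split; rewrite //= dv eqxx mul1n //.
by case: ifP.
Qed.

Hypothesis whole : forall v (i j : 'I_n), (inr (v, i) \in K) = (inr (v, j) \in K).

Let core0 : 'I_n := Ordinal n_gt0.
Let Y := [set v | inr (v, core0) \in K].

(** A dart that [K] separates from the cores at its end; the pairs [pr d i] then contribute [n * n]
    to the cut. *)
Let exceptional (d : dart) := (inl d \in K) != (dend d \in Y).

Let pr (d : dart) (i : 'I_n) : gadget * gadget :=
  if inl d \in K then (inl d, inr (dend d, i)) else (inr (dend d, i), inl d).

Lemma core_whole v i : (inr (v, i) \in K) = (v \in Y).
Proof. by rewrite inE; apply: whole. Qed.

Lemma subYX : Y \subset X.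
Proof. by apply/subsetP => v; rewrite inE => /core_in_cut. Qed.

Lemma prP d i : exceptional d ->
  [/\ (pr d i).1 \in K, (pr d i).2 \notin K & n <= gadget_weight (pr d i).2 (pr d i).1].
Proof.
rewrite /exceptional /pr; case: ifP => dK /= dY; rewrite ?dK ?core_whole eqxx mul1n.
  by split=> //; case: (_ \in Y) dY.
by split; [case: (_ \in Y) dY | | case: ifP].
Qed.

Lemma pr_inj d d' i i' : pr d i = pr d' i' -> d = d' /\ i = i'.
Proof. by rewrite /pr; case: ifP => _; case: ifP => _ // []. Qed.

(** Together they contribute [2 * n * n], and [r <= 2 * n] because [2 * k <= r]. *)
Lemma two_exceptional_cut d d' :
  exceptional d -> exceptional d' -> d != d' -> r * n <= cut.
Proof.
move=> xd xd' dNd'.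
apply: (@leq_trans (\sum_(b in [set: bool * 'I_n]) n)).
  rewrite sum_nat_const cardsT card_prod card_bool card_ord leq_mul2r.
  by apply/orP; right; rewrite /n; lia.
apply: (cut_ge (p := fun b => pr (if b.1 then d else d') b.2)) => [[b i] [b' i'] _ _|[b i] _] /=.
  case/pr_inj => + ->; case: b b' => [] [] // /eqP; first by rewrite (negbTE dNd').
  by rewrite eq_sym (negbTE dNd').
by apply: prP; case: b.
Qed.

(** The [n * n] units at [d] and the [k * n] between [d'] and its flip add up to [r * n]. *)
Lemma exceptional_crossing_cut d d' :
  exceptional d -> inl d' \in K -> inl (flip d') \notin K -> r * n <= cut.
Proof.
move=> xd d'K fK.
pose p (o : option 'I_n) : gadget * gadget :=
  if o is Some i then pr d i else (inl d', inl (flip d')).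
have -> : r * n = \sum_(o in [set: option 'I_n]) (if o is Some _ then n else k * n).
  rewrite (eq_bigl predT) => [|o]; last by rewrite inE.
  rewrite (bigD1 None) //= (reindex_omap Some id) /=; last by case.
  rewrite (eq_bigl predT) => [|i]; last by rewrite /= eqxx.
  by rewrite sum_nat_const card_ord -mulnDl knr.
apply: (cut_ge (p := p)) => [[i|] [j|] _ _|[i|] _] //=.
- by case/pr_inj => _ ->.
- by rewrite /pr; case: ifP.
- by rewrite /pr; case: ifP.
- exact: prP.
- by split; rewrite ?flipK ?eqxx ?mul1n.
Qed.

(** If [K] is closed under [flip], the edge of [d] is the only one joining [Y] to the rest of [X],
    hence a bridge, unless it leaves [X]; in that case [d] supplies [r] to each of its [n] cores. *)
Lemma one_exceptional_cut d :
  exceptional d -> (forall d', exceptional d' -> d' = d) -> r * n <= cut.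
Proof.
move=> xd only.
have nonx d' : d' != d -> (inl d' \in K) = (dend d' \in Y).
  by move=> d'N; apply/eqP/negPn; apply: contra d'N => /only->.
have [/existsP[d' /andP[d'K fK]]|/existsPn closedK] :=
    boolP [exists d', (inl d' \in K) && (inl (flip d') \notin K)].
  exact: exceptional_crossing_cut xd d'K fK.
have flipKin d' : (inl (flip d') \in K) = (inl d' \in K).
  have imp d1 : inl d1 \in K -> inl (flip d1) \in K.
    by move=> d1K; move: (closedK d1); rewrite d1K negbK.
  by apply/idP/idP => [/imp|/imp//]; rewrite flipK.
have fdN : flip d != d by apply: flip_neq.
have crossing1 d1 : crossing X Y = [set d1] -> r * n <= cut.
  by move=> eq1; have := brX subYX; rewrite eq1 cards1.
have [dK|dK] := boolP (inl d \in K).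
  have dY : dend d \notin Y by move: xd; rewrite /exceptional dK; case: (_ \in Y).
  have fdY : dend (flip d) \in Y by rewrite -nonx // flipKin.
  have dX : dend d \in X by case: (dart_in_cut dK).
  apply: (crossing1 (flip d)); apply/setP => d'; rewrite in_set1 inE in_setD.
  have [->|d'N] := eqVneq d' (flip d); first by rewrite fdY flipK dY dX.
  apply/negbTE; rewrite negb_and negb_and negbK.
  have [d'Y|//] := boolP (dend d' \in Y); apply/orP; right; apply/orP; left.
  have d'Nd : d' != d by apply: contraNneq dY => <-.
  rewrite -nonx ?flipKin ?nonx //.
  by apply: contraNneq d'N => <-; rewrite flipK.
have dY : dend d \in Y by move: xd; rewrite /exceptional (negbTE dK); case: (_ \in Y).
have fdY : dend (flip d) \notin Y by rewrite -nonx // flipKin.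
have [fdX|fdX] := boolP (dend (flip d) \in X).
  apply: (crossing1 d); apply/setP => d'; rewrite in_set1 inE in_setD.
  have [->|d'N] := eqVneq d' d; first by rewrite dY fdY fdX.
  apply/negbTE; rewrite negb_and negb_and negbK.
  have [d'Y|//] := boolP (dend d' \in Y); apply/orP; right; apply/orP; left.
  have d'K : inl d' \in K by rewrite nonx.
  rewrite -nonx ?flipKin //.
  by apply: contraNneq dK => <-; rewrite flipKin.
have -> : r * n = \sum_(i in [set: 'I_n]) r by rewrite sum_nat_const cardsT card_ord mulnC.
apply: (cut_ge (p := pr d)) => [i j _ _ /pr_inj[]//|i _]; have [? ? _] := prP i xd; split=> //.
by rewrite /pr (negbTE dK) /= eqxx mul1n (negbTE fdX).
Qed.

(** Here [K] consists of all darts and cores at [Y], so [#|Y| * (r + n)] is odd, and [#|Y|], [k] and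
    [r] are odd. By parity and the absence of bridges at least three edges join [Y] to the rest of
    [X]; each carries [k * n], and [r <= 3 * k]. *)
Lemma no_exceptional_cut : (forall d, ~~ exceptional d) -> r * n <= cut.
Proof.
move=> nonx; have dartK d : (inl d \in K) = (dend d \in Y).
  by apply/eqP/negPn/nonx.
have [coreY subY] := (core_whole, subYX); move: Y dartK coreY subY => Z dartK coreY subY.
have cardK : #|K| = #|Z| * (r + n).
  rewrite -sum1_card big_sumType /= mulnDr; congr (_ + _).
    by rewrite sum1_card -(card_darts_in Z regG); apply: eq_card => d; rewrite inE; apply: dartK.
  rewrite sum1_card -[n in RHS]card_ord -cardsT -cardsX.
  by apply: eq_card => -[v i]; rewrite in_setX in_setT andbT; apply: coreY.
move: oddK; rewrite cardK oddM => /andP[oddY oddrn].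
have oddk : odd k by move: oddrn; rewrite oddD /n oddB; [case: (odd r) (odd k) => [] [] | lia].
pose C := crossing X Z.
have oddC : odd #|C|.
  rewrite (odd_crossing regG) ?oddM ?oddY ?(odd_kr oddk) // => d.
  by rewrite -dartK => /dart_in_cut[].
have C1 : #|C| != 1 by apply: brX subY.
have C3 : 3 <= #|C| by case: #|C| oddC C1 => [|[|[|]]].
apply: (@leq_trans (\sum_(d in C) k * n)).
  by rewrite sum_nat_const mulnA leq_mul2r (leq_trans le_r3k) ?orbT // leq_mul2r C3 orbT.
apply: (cut_ge (p := fun d => (inl d, inl (flip d)))) => [d d' _ _ []//|d].
by rewrite inE in_setD /= !dartK flipK eqxx mul1n => /and3P[-> -> _].
Qed.

End Cut.

Lemma gadget_cut (K : {set gadget}) : odd #|K| -> [disjoint K & gadget_free] ->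
  r * n <= \sum_(x in K) \sum_(y | y \notin K) gadget_weight y x.
Proof.
move=> oddK disjK.
have [/existsP[v /existsP[i /existsP[j /andP[iK jK]]]]|nosplit] :=
  boolP [exists v : vertex G, exists i : 'I_n, exists j : 'I_n,
           (inr (v, i) \in K) && (inr (v, j) \notin K)].
  exact: split_vertex_cut iK jK.
have imp v (i j : 'I_n) : inr (v, i) \in K -> inr (v, j) \in K.
  move=> iK; apply/negPn/negP => jK; move/negP: nosplit; apply.
  by apply/existsP; exists v; apply/existsP; exists i; apply/existsP; exists j; rewrite iK.
have whole v (i j : 'I_n) : (inr (v, i) \in K) = (inr (v, j) \in K).
  by apply/idP/idP; apply: imp.
pose ex (d : dart) := (inl d \in K) != (dend d \in [set v | inr (v, Ordinal n_gt0) \in K]).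
have [/existsP[d xd]|/existsPn nox] := boolP [exists d, ex d]; last first.
  exact: (no_exceptional_cut oddK disjK).
have [/existsP[d' /andP[xd' dNd']]|/existsPn only] := boolP [exists d', ex d' && (d != d')].
  exact: (two_exceptional_cut oddK disjK whole xd xd' dNd').
apply: (one_exceptional_cut disjK whole xd) => d' xd'; apply/eqP; rewrite eq_sym.
by move: (only d'); rewrite negb_and negbK => /orP[/negP[]|].
Qed.

(** The cores claim [n] of the [r] darts at each vertex of [X] and leave [k]; an unclaimed dart
    inside [X] is matched to its flip, so both darts of its edge are in [H]. *)
Theorem local_factor : exists H : {set dart},
  (forall v, v \in X -> #|[set d in H | dend d == v]| = k) /\
  (forall d, dend d \in X -> dend (flip d) \in X -> (flip d \in H) = (d \in H)).
Proof.
have [||m pm] := weighted_tutte gadget_rel_sym even_gadget _ _ gadget_support gadget_capacity gadget_cut.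
- by rewrite muln_gt0 r_gt0.
- by move=> x y xF yF xNy; rewrite /gadget_rel /= xF yF xNy orbT.
pose own d : bool := if m (inl d) is inr c then c.1 == dend d else false.
have matched_in x y : m x = y -> x \notin gadget_free -> gadget_adj x y.
  move=> <- xF; have [_ _] := pm x.
  by rewrite /gadget_rel /= (negbTE xF) orbF.
have dartF d : dend d \in X -> dend (flip d) \in X -> inl d \notin gadget_free.
  by move=> dX fdX; rewrite inE dX fdX.
exists [set d | ~~ own d]; split=> [v vX|d dX fdX].
  have coreF i : inr (v, i) \notin gadget_free by rewrite inE vX.
  have [h hP] : exists h : 'I_n -> dart, forall i, m (inr (v, i)) = inl (h i).
    apply: (fin_all_exists (P := fun i d => m (inr (v, i)) = inl d)) => i; have := matched_in _ _ (erefl _) (coreF i).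
    by case: (m _) => // d _; exists d.
  have dend_h i : dend (h i) = v by have := matched_in _ _ (hP i) (coreF i) => /eqP.
  have mh i : m (inl (h i)) = inr (v, i) by rewrite -hP; case: (pm (inr (v, i))).
  have h_inj : injective h by move=> i j eqh; have := mh i; rewrite eqh mh => -[].
  have cardown : #|[set d | dend d == v & own d]| = n.
    rewrite -[RHS]card_ord -cardsT -(card_imset _ h_inj); apply: eq_card => d; rewrite inE.
    apply/andP/imsetP => [[/eqP dv]|[i _ ->]]; last first.
      by rewrite /own mh dend_h !eqxx.
    rewrite /own dv; case md: (m (inl d)) => [//|[u i]] /= /eqP uv.
    exists i => //; have [mmd _ _] := pm (inl d).
    by move: mmd; rewrite md uv hP => -[].
  have := cardsID [set d | own d] [set d | dend d == v].
  rewrite (card_darts_at v regG) -knr.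
  have -> : [set d | dend d == v] :&: [set d | own d] = [set d | dend d == v & own d].
    by apply/setP => d; rewrite !inE.
  rewrite cardown addnC => /addIn <-.
  by apply: eq_card => d; rewrite !inE andbC.
have imp d1 : dend d1 \in X -> dend (flip d1) \in X -> ~~ own d1 -> ~~ own (flip d1).
  move=> d1X fd1X; rewrite /own.
  have := matched_in _ _ (erefl _) (dartF _ d1X fd1X).
  case md: (m (inl d1)) => [d2|c] /= /eqP; last by move=> ->; rewrite eqxx.
  by move=> eqd _; have [mmd _ _] := pm (inl d1); rewrite -eqd -md mmd.
rewrite !inE; apply/idP/idP; last exact: imp.
by move/(imp _ fdX); rewrite flipK; apply.
Qed.

End Gadget.
End Darts.

(** * Flows *)

Section Flows.

Variable G : multigraph.
Implicit Types (X Y : {set vertex G}) (d : dart G) (f : edge G -> int).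

(* An edge leaving X is its own mirror: in the bipartite double cover of X it
   becomes a single edge joining both copies of its end in X. *)
Definition mirror X d : dart G :=
  if (dend d \in X) && (dend (flip d) \in X) then flip d else d.

Lemma mirrorK X : involutive (mirror X).
Proof.
move=> d; rewrite {2}/mirror; case: ifP => [/andP[dX fdX]|inner]; rewrite /mirror.
  by rewrite flipK fdX dX.
by rewrite inner.
Qed.

(** Each colour class is a perfect matching of the double cover, where [d] joins its end in the
    first copy to the end of [mirror X d] in the second. *)
Definition colouring X r (c : dart G -> nat) : Prop :=
  (forall d, c d < r) /\
  (forall v i, i < r -> #|[set d | (dend d == v) && (c d == i)]| = 1 /\
                        #|[set d | (dend (mirror X d) == v) && (c d == i)]| = 1).

Lemma exists_colouring X r : regular r G -> exists c, colouring X r c.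
Proof.
move=> regG.
have [|c [c_lt regc]] := @biregular_colouring _ _ (@dend G) (@dend G \o mirror X) r setT.
  move=> v; rewrite -{1 2}(card_darts_at v regG); split.
    by apply: eq_card => d; rewrite !inE.
  rewrite -(card_imset _ (can_inj (mirrorK X))); apply: eq_card => d; rewrite !inE.
  apply/imsetP/idP => [[d' + ->]|dv]; first by rewrite !inE.
  by exists (mirror X d); rewrite ?mirrorK // !inE /= mirrorK.
exists c; split=> [d|v i ltir]; first by apply: c_lt; rewrite inE.
have [e1 e2] := regc i ltir v; split; [rewrite -[RHS]e1 | rewrite -[RHS]e2];
by apply: eq_card => d; rewrite !inE andbC.
Qed.

Lemma recolouring X r c d0 j : colouring X r c -> j < r ->
  exists2 c', colouring X r c' & c' d0 = j.
Proof.
move=> [c_lt cc] ltjr.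
pose s i := if i == c d0 then j else if i == j then c d0 else i.
have sK : involutive s.
  by move=> i; rewrite /s; do !case: eqP => //; congruence.
have s_lt i : i < r -> s i < r by rewrite /s; do !case: ifP => _ //.
exists (s \o c); last by rewrite /s /= eqxx.
split=> [d|v i ltir] /=; first exact/s_lt/c_lt.
have [e1 e2] := cc v (s i) (s_lt i ltir); split; [rewrite -[RHS]e1 | rewrite -[RHS]e2];
by apply: eq_card => d; rewrite !inE (can2_eq sK sK).
Qed.

Lemma sum_colours X r c (F : nat -> int) v : colouring X r c ->
  (\sum_(d | dend d == v) F (c d) = \sum_(i < r) F i /\
   \sum_(d | dend (mirror X d) == v) F (c d) = \sum_(i < r) F i)%R.
Proof.
case=> c_lt cc.
have sum1 (Q : pred (dart G)) :
    (forall i, i < r -> #|[set d | Q d && (c d == i)]| = 1) ->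
  (\sum_(d | Q d) F (c d) = \sum_(i < r) F i)%R.
  move=> Q1; rewrite (partition_big (fun d => Ordinal (c_lt d)) predT) //=.
  apply: eq_bigr => i _; rewrite (eq_bigr (fun=> F i)) => [|d /andP[_ /eqP<-]] //.
  rewrite sumr_const -[RHS]mulr1n -(Q1 i (ltn_ord i)); congr (_ *+ _)%R.
  by apply: eq_card => d; rewrite inE.
by split; apply: sum1 => i ltir; case: (cc v i ltir).
Qed.

(** At a vertex the terms [y d] sum over one side of the double cover and the mirrored terms over
    the other. An edge leaving [X] receives twice its label. *)
Lemma double_cover_flow X (y : dart G -> int) :
    (forall v, v \in X -> \sum_(d | dend d == v) y d = 0)%R ->
    (forall v, v \in X -> \sum_(d | dend (mirror X d) == v) y d = 0)%R ->
  exists f, (forall v, v \in X -> \sum_e f e *+ incidence v e = 0)%R /\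
    (forall d, dend d \in X -> f d.1 = y d + y (mirror X d))%R.
Proof.
move=> y0 y0m.
(* The chosen dart ends in [X] whenever some dart of the edge does; for an edge inside [X] both
   choices agree. *)
pose f e := (let d := if dend (e, false) \in X then (e, false) else (e, true) in
             y d + y (mirror X d))%R.
have fE d : dend d \in X -> (f d.1 = y d + y (mirror X d))%R.
  case: d => e [] dX; rewrite /f /=; case: ifPn => // d'X; last by rewrite dX in d'X.
  by rewrite /mirror /flip /= dX d'X /= addrC.
exists f; split=> // v vX.
rewrite sum_darts_at (eq_bigr (fun d => y d + y (mirror X d))%R) => [|d /eqP dv]; last first.
  by rewrite fE ?dv.
rewrite big_split /= y0 // add0r.
rewrite (reindex_inj (can_inj (mirrorK X))) /= -[RHS](y0m v vX).
by apply: eq_bigr => d _; rewrite mirrorK.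
Qed.

(* Absolute values 2 and 4 on the edges leaving X are the only ones compatible
   with parity when such an edge is a bridge. *)
Definition local_flow X f : Prop :=
  [/\ forall v, v \in X -> (\sum_e f e *+ incidence v e = 0)%R,
      forall d, dend d \in X -> 0 < `|f d.1| < 5
    & forall d, dend d \in X -> dend (flip d) \notin X -> `|f d.1| \in [:: 2; 4]].

Lemma local_flow_opp X f : local_flow X f -> local_flow X (fun e => - f e)%R.
Proof.
case=> f0 f5 f24; split=> [v vX|d dX|d dX fdX]; last 2 first.
- by rewrite abszN f5.
- by rewrite abszN f24.
rewrite (eq_bigr (fun e => - (f e *+ incidence v e))%R) => [|e _]; last exact: mulNrn.
by rewrite sumrN f0 ?oppr0.
Qed.

(** The labels [- 1] on [H] and [2] off it sum to [2 * (r - k) - k] at each vertex, which the first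
    [2 * r - 3 * k] colours cancel. Both darts of an inner edge agree about [H], so their final
    labels have the same sign. *)
Lemma factor_flow r k X (H : {set dart G}) c :
    regular r G -> r <= 3 * k -> 2 * k <= r ->
    (forall v, v \in X -> #|[set d in H | dend d == v]| = k) ->
    (forall d, dend d \in X -> dend (flip d) \in X -> (flip d \in H) = (d \in H)) ->
    colouring X r c ->
  exists2 f, local_flow X f &
    forall d, dend d \in X -> dend (flip d) \notin X ->
      f d.1 = (((if d \in H then - 1 else 2) - (c d < 2 * r - 3 * k)%N%:R) *+ 2)%R.
Proof.
move=> regG le_r3k le_2kr Hk Hflip colc; set g := 2 * r - 3 * k.
pose h d : int := (if d \in H then - 1 else 2)%R.
pose y d : int := (h d - (c d < g)%N%:R)%R.
have Hmirror d : dend d \in X -> (mirror X d \in H) = (d \in H).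
  by rewrite /mirror; case: ifP => // /andP[dX fdX] _; apply: Hflip.
have sumg : (\sum_(i < r) (i < g)%N%:R = g%:R :> int)%R.
  rewrite -natr_sum; congr (_%:R)%R.
  have le_gr : g <= r by rewrite /g; lia.
  rewrite -(big_mkord xpredT (fun i => (i < g) : nat)) (big_cat_nat (n := g)) //=.
  rewrite (eq_big_nat _ _ (F2 := fun=> 1)) => [|i /andP[_ ->]] //.
  rewrite [X in _ + X](eq_big_nat _ _ (F2 := fun=> 0)) => [|i /andP[legi _]]; last first.
    by rewrite ltnNge legi.
  by rewrite !sum_nat_const_nat muln0 addn0 muln1 subn0.
have sumh v : v \in X -> (\sum_(d | dend d == v) h d = g%:R)%R.
  move=> vX; rewrite (eq_bigr (fun d => 2 - (d \in H)%:R *+ 3)%R) => [|d _]; last first.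
    by rewrite /h; case: (d \in H).
  rewrite sumrB sumr_const sumrMnl -natr_sum -big_mkcondr /= sum1dep_card.
  have -> : #|[pred d | dend d == v]| = r.
    by rewrite -(card_darts_at v regG) cardsE.
  have -> : #|[set d | (dend d == v) && (d \in H)]| = k.
    by rewrite -(Hk v vX); apply: eq_card => d; rewrite !inE andbC.
  by rewrite /g; lia.
have hmirror d : dend d \in X -> h (mirror X d) = h d.
  by move=> dX; rewrite /h Hmirror.
have [|v vX|f [f0 fE]] := @double_cover_flow X y.
- move=> v vX; rewrite /y sumrB sumh // (sum_colours (fun i => (i < g)%N%:R%R) v colc).1.
  by rewrite sumg subrr.
- rewrite /y sumrB (sum_colours (fun i => (i < g)%N%:R%R) v colc).2 sumg.
  rewrite (reindex_inj (can_inj (mirrorK X))) /=.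
  rewrite (eq_big (fun d => dend d == v) h) => [|d|d /eqP]; rewrite ?mirrorK //.
    by rewrite sumh // subrr.
  by move=> dv; rewrite hmirror ?dv.
have fX d : dend d \in X -> f d.1 = (h d *+ 2 - (c d < g)%N%:R - (c (mirror X d) < g)%N%:R)%R.
  by move=> dX; rewrite fE // /y hmirror //; lia.
have fbd d : dend d \in X -> dend (flip d) \notin X -> f d.1 = ((h d - (c d < g)%N%:R) *+ 2)%R.
  by move=> dX fdX; rewrite fX // /mirror dX (negbTE fdX) /=; lia.
exists f => //; split=> // d dX.
  by rewrite fX // /h; case: (d \in H) (_ < g) (_ < g) => [] [] [].
by move=> fdX; rewrite fbd // /h; case: (d \in H) (_ < g) => [] [].
Qed.

Lemma glue_flow X Y d1 f1 f2 : Y \subset X -> crossing X Y = [set d1] ->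
    local_flow Y f1 -> local_flow (X :\: Y) f2 -> f1 d1.1 = f2 d1.1 ->
  exists f, [/\ local_flow X f,
    forall d, dend d \in Y -> f d.1 = f1 d.1
    & forall d, dend d \in X :\: Y -> f d.1 = f2 d.1].
Proof.
move=> YX eqC [f10 f15 f124] [f20 f25 f224] eq12.
pose f e := if (dend (e, false) \in Y) || (dend (e, true) \in Y) then f1 e else f2 e.
have fY d : dend d \in Y -> f d.1 = f1 d.1.
  by case: d => e [] dY; rewrite /f /= dY ?orbT.
have fXY d : dend d \in X :\: Y -> f d.1 = f2 d.1.
  move=> dXY; have [dX dY] := setDP dXY; have [fdY|fdY] := boolP (dend (flip d) \in Y).
    have : flip d \in crossing X Y by rewrite inE fdY flipK dXY.
    by rewrite eqC inE => /eqP eqd; rewrite -[d.1]/(flip d).1 eqd -eq12 -eqd fY.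
  case: d dY fdY {dXY dX} => e b; rewrite /f /flip /=.
  by case: b => /negbTE dY /negbTE fdY; rewrite dY fdY.
have splitX d : dend d \in X -> dend d \in Y \/ dend d \in X :\: Y.
  by move=> dX; have [dY|dY] := boolP (dend d \in Y); [left | right; rewrite inE dY].
exists f; split=> //; split=> [v vX|d dX|d dX fdX].
- have [vY|vY] := boolP (v \in Y).
    rewrite sum_darts_at -[RHS](f10 v vY) sum_darts_at; apply: eq_bigr => d /eqP dv.
    by rewrite fY ?dv.
  have vXY : v \in X :\: Y by rewrite inE vY.
  rewrite sum_darts_at -[RHS](f20 v vXY) sum_darts_at; apply: eq_bigr => d /eqP dv.
  by rewrite fXY ?dv.
- by have [dY|dY] := splitX d dX; [rewrite fY ?f15 | rewrite fXY ?f25].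
- have [dY|dY] := splitX d dX.
    by rewrite fY ?f124 //; apply: contra fdX; apply: (subsetP YX).
  by rewrite fXY ?f224 //; apply: contra fdX => /setDP[].
Qed.

Lemma bridgeless_local_flow r X d0 (t : int) :
    regular r G -> odd r -> 4 < r -> bridgeless X -> `|t| \in [:: 2; 4] ->
  exists2 f, local_flow X f & dend d0 \in X -> dend (flip d0) \notin X -> f d0.1 = t.
Proof.
move=> regG oddr r5 brX t24; pose k := r./2.
have eqr : r = k.*2.+1 by rewrite -[LHS]odd_double_half oddr.
have [||||H [Hk Hflip]] := @local_factor G r k X regG _ _ _ _ brX; try lia.
have [c0 colc0] := exists_colouring X regG.
(* Membership of d0 in the factor fixes the sign of the flow there and the colour
   of d0 its absolute value; a wrong sign is corrected by negation. *)
pose j := if (d0 \in H) (+) (`|t| == 4) then r.-1 else 0.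
have ltjr : j < r by rewrite /j; case: ifP; lia.
have [c colc cd0] := recolouring d0 colc0 ltjr.
have [||f lf fbd] := factor_flow regG _ _ Hk Hflip colc; try lia.
have abs_f : dend d0 \in X -> dend (flip d0) \notin X -> `|f d0.1| = `|t|.
  move=> dX fdX; rewrite fbd // cd0 /j.
  (* With [r = 2 * k + 1] the threshold is [k + 2]; colour [0] is below it and colour [r.-1] is not,
     as [k] is at least 2. *)
  have -> : (if (d0 \in H) (+) (`|t| == 4) then r.-1 else 0) < 2 * r - 3 * k
            = ~~ ((d0 \in H) (+) (`|t| == 4)) by case: ifP => _; lia.
  by move: t24; rewrite !inE => /orP[]/eqP->; case: (d0 \in H).
have [eqt|neqt] := eqVneq (f d0.1) t; first by exists f.
exists (fun e => - f e)%R; first exact: local_flow_opp.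
move=> dX fdX; have := abs_f dX fdX; lia.
Qed.

(** Induction on [#|X|], cutting at a bridge. The side of [d0] is solved first; the bridge leaves
    that side, so its value there has absolute value 2 or 4 and can be prescribed on the other
    side. *)
Theorem odd_local_flow r X d0 (t : int) :
    regular r G -> odd r -> 4 < r -> `|t| \in [:: 2; 4] ->
  exists2 f, local_flow X f & dend d0 \in X -> dend (flip d0) \notin X -> f d0.1 = t.
Proof.
move=> regG oddr r5.
elim: {X}#|X| {-2}X (leqnn #|X|) d0 t => [|N IH] X leX d0 t t24.
  apply: bridgeless_local_flow regG oddr r5 _ t24 => Y /subset_leqif_cards[leY _].
  have : crossing X Y = set0.
    have /eqP : #|Y| == 0 by lia.
    by move/cards0_eq=> ->; apply/setP => d; rewrite !inE.
  by move=> ->; rewrite cards0.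
have [/existsP[Y /andP[YX /cards1P[d1 eqC]]]|nobr] :=
    boolP [exists Y : {set vertex G}, (Y \subset X) && (#|crossing X Y| == 1)]; last first.
  apply: (bridgeless_local_flow _ regG oddr r5 _ t24) => Y YX.
  by move/existsPn/(_ Y): nobr; rewrite YX.
have : d1 \in crossing X Y by rewrite eqC inE.
rewrite inE => /andP[d1Y fd1XY]; have [fd1X fd1Y] := setDP fd1XY.
have ltY : #|Y| <= N.
  rewrite -ltnS; apply: leq_trans leX; apply: proper_card; apply/properP; split=> //.
  by exists (dend (flip d1)).
have ltXY : #|X :\: Y| <= N.
  rewrite -ltnS; apply: leq_trans leX; apply: proper_card; apply/properP.
  split; first exact: subsetDl.
  by exists (dend d1); rewrite ?(subsetP YX) // inE d1Y.
have fd1XYN : dend (flip (flip d1)) \notin X :\: Y by rewrite flipK inE d1Y.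
have [d0Y|d0Y] := boolP (dend d0 \in Y).
  have [f1 lf1 f1d0] := IH Y ltY d0 t t24.
  have s24 : `|f1 d1.1| \in [:: 2; 4] by case: lf1 => _ _; apply.
  have [f2 lf2 f2d1] := IH _ ltXY (flip d1) _ s24.
  have [f [lf fY fXY]] := glue_flow YX eqC lf1 lf2 (esym (f2d1 fd1XY fd1XYN)).
  exists f => // d0X fd0X; rewrite fY // f1d0 //.
  by apply: contra fd0X; apply: (subsetP YX).
have [f2 lf2 f2d0] := IH _ ltXY d0 t t24.
have s24 : `|f2 d1.1| \in [:: 2; 4] by case: lf2 => _ _ /(_ (flip d1)); apply.
have [f1 lf1 f1d1] := IH Y ltY d1 _ s24.
have [f [lf fY fXY]] := glue_flow YX eqC lf1 lf2 (f1d1 d1Y fd1Y).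
exists f => // d0X fd0X.
by rewrite fXY ?f2d0 // inE ?d0Y // negb_and fd0X orbT.
Qed.

End Flows.

(** * The cases of the degree *)

Section ZeroSumFlows.

Variable G : multigraph.

Lemma local_flow_setT (f : edge G -> int) : local_flow setT f -> zero_sum_kflow 5 f.
Proof.
case=> f0 f5 _; have f5e e : 0 < `|f e| < 5 by apply: (f5 (e, true)); rewrite inE.
split; last by move=> e; have := f5e e; lia.
by split=> [e|v]; [have := f5e e; lia | apply: f0; rewrite inE].
Qed.

Lemma cubic_flow : regular 3 G -> exists f : edge G -> int, zero_sum_kflow 5 f.
Proof.
move=> regG; have [c colc] := exists_colouring [set: vertex G] regG.
pose y i : int := if i == 0 then (- 2)%R else 1%R.
have sumy : (\sum_(i < 3) y i = 0)%R by rewrite !big_ord_recl big_ord0.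
have [v _|v _|f [f0 fE]] := @double_cover_flow G setT (y \o c).
- by rewrite (sum_colours y v colc).1.
- by rewrite (sum_colours y v colc).2.
exists f; apply: local_flow_setT; split=> // d dT; last by rewrite inE.
(* Two labels from [1] and [- 2] add up to [2], [- 1] or [- 4]. *)
by rewrite fE // /y /=; do 2!case: ifP.
Qed.

Lemma even_flow r : regular r G -> ~~ odd r -> 3 < r ->
  exists f : edge G -> int, zero_sum_kflow 5 f.
Proof.
(* An even [k] with [2 * k <= r]; also [r <= 3 * k], because [r] is even and at least 4. *)
move=> regG evr r4; pose k := (r %/ 4).*2.
(* With even degrees every edge cut is even. *)
have brT : bridgeless [set: vertex G].
  move=> Y _; apply/eqP=> C1; have := @odd_crossing G r setT Y regG.
  by rewrite C1 oddM (negbTE evr) andbF => /(_ (fun d _ => in_setT _)).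
have [||||H [Hk Hflip]] := @local_factor G r k setT regG _ _ _ _ brT; rewrite /k; try lia.
have [c colc] := exists_colouring [set: vertex G] regG.
have [||f lf _] := factor_flow regG _ _ Hk Hflip colc; rewrite /k; try lia.
by exists f; apply: local_flow_setT.
Qed.

End ZeroSumFlows.

Theorem theorem6 (r : nat) (r_ge3 : (3 <= r)%N) (r_neq5 : r <> 5%N)
    (G : multigraph) (G_regular : regular r G) :
  exists f : edge G -> int, zero_sum_kflow 5 f.
Proof.
have [r3|r_neq3] := eqVneq r 3; first by apply: cubic_flow; rewrite -r3.
have [oddr|evr] := boolP (odd r); last by apply: even_flow G_regular evr _; lia.
(* [odd_local_flow] takes a dart; a graph without darts has no edges, and any function will do. *)
have [d0 _|noD] := pickP (fun _ : dart G => true).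
  have [||f lf _] := @odd_local_flow G r setT d0 2 G_regular oddr; [lia|by []|].
  by exists f; apply: local_flow_setT.
exists (fun=> 1%R); apply: local_flow_setT; split=> [v _|d|d]; try by have := noD d.
by rewrite big1 // => e; have := noD (e, true).
Qed.
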